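(* Let $h\in(0,1]$. Let $f:h\mathbb{Z}^2\times\mathbb{R}\to\mathbb{R}$ and let $u:h\mathbb{Z}^2\to\mathbb{R}$ be a solution of $$\mathcal{L}u_i=f(i,u_i)\qquad\text{for all } i\in h\mathbb{Z}^2 .$$ Assume that there exist functions $L_f^+,L_f^-:h\mathbb{Z}^2\times\mathbb{R}\to\mathbb{R}$ and finite positive constants $\kappa_0^+,\kappa_0^-$ such that, for all $i\in h\mathbb{Z}^2$, $$\sum_{j=1}^2\frac{\big|f(i+he_j,u_{i+he_j})-f(i,u_i)-L_f^+(i,u_i)(u_{i+he_j}-u_i)\big|}{h}\le\kappa_0^+\,h$$ and $$\sum_{j=1}^2\frac{\big|f(i,u_i)-f(i-he_j,u_{i-he_j})-L_f^-(i,u_i)(u_i-u_{i-he_j})\big|}{h}\le\kappa_0^-\,h .$$ Assume also that $$\sum_{j=1}^2|u_{i+he_j}-u_i|^2>0\quad\text{and}\quad\sum_{j=1}^2|u_{i-he_j}-u_i|^2>0\qquad\text{for all } i\in h\mathbb{Z}^2,$$ that $$\kappa_1^\pm:=\sup_{i\in h\mathbb{Z}^2,\,1\le j\le2}|\mathcal{D}_j^\pm u_i|<+\infty$$ for both choices of sign, that $\kappa_2^+<+\infty$ and $\kappa_2^-<+\infty$, and that there exist $\vartheta_\infty^+,\vartheta_\infty^-\in(-\pi,\pi]$ for which $\kappa_m^+$ and $\kappa_m^-$ are finite for all $m\in\{3,4,5,6,7\}$ (the quantities $\kappa_2^\pm,\dots,\kappa_7^\pm$ being those defined in the context in terms of $u$,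 $h$, $\kappa_0^\pm$ and $\vartheta_\infty^\pm$). Set $\kappa_m:=\kappa_m^++\kappa_m^-$ for $m\in\{0,\dots,7\}$. Then $$\sum_{i\in h\mathbb{Z}^2}\sum_{j=1}^2\Big[(\rho_i^+)^2\Big(|\mathcal{D}_j^+\vartheta_i^+|^2+|\mathcal{D}_j^-\vartheta_i^+|^2\Big)+(\rho_i^-)^2\Big(|\mathcal{D}_j^+\vartheta_i^-|^2+|\mathcal{D}_j^-\vartheta_i^-|^2\Big)\Big]\le C\,h,$$ where $$C:=4\left(\kappa_2+2e^{2\pi}\kappa_3+2e^{2\pi}\kappa_4+2\kappa_5+\kappa_6+\kappa_7\right).$$
   Context: Notation. $e_1=(1,0)$, $e_2=(0,1)$, and $\mathcal{I}=\sqrt{-1}$. For a function $g:h\mathbb{Z}^2\to\mathbb{R}$, $i\in h\mathbb{Z}^2$ and $j\in\{1,2\}$: $$\mathcal{D}_j^+g_i:=\frac{g_{i+he_j}-g_i}{h},\quad \mathcal{D}_j^-g_i:=\frac{g_i-g_{i-he_j}}{h},\quad \mathcal{L}_jg_i:=\frac{g_{i+he_j}+g_{i-he_j}-2g_i}{h^2},\quad \mathcal{L}:=\mathcal{L}_1+\mathcal{L}_2 .$$ $\mathcal{L}_j^2$ denotes $\mathcal{L}_j$ applied twice, $\mathcal{D}_j^\pm(\mathcal{D}_j^\pm g)_k$ is $\mathcal{D}_j^\pm$ applied to the function $i\mapsto\mathcal{D}_j^\pm g_i$ and evaluated at $k$, and $\mathcal{D}_j^+(\rho_i^s)^2$, $\mathcal{D}_j^-(\rho_i^s)^2$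 denote $\mathcal{D}_j^+$, $\mathcal{D}_j^-$ of the function $i\mapsto(\rho_i^s)^2$ evaluated at $i$. For a sign $s\in\{+,-\}$ set $U_i^s:=\mathcal{D}_1^su_i+\mathcal{I}\,\mathcal{D}_2^su_i\in\mathbb{C}$ and $\rho_i^s:=|U_i^s|$. Under the non-vanishing assumptions in the claim one has $\rho_i^s>0$, and $\vartheta_i^s\in(-\pi,\pi]$ is the (unique) angle such that $U_i^s=\rho_i^se^{\mathcal{I}\vartheta_i^s}$. For $s\in\{+,-\}$, with all sums over $i\in h\mathbb{Z}^2$ and $1\le j\le2$ (or over $i\in h\mathbb{Z}^2$ only for $\kappa_5^s$): $$\kappa_2^s:=\sum_{i,j}(\rho_i^s)^2\Big(|\mathcal{D}_j^+\vartheta_i^s|\,|\mathcal{D}_j^+(\mathcal{D}_j^+\vartheta^s)_{i-he_j}|+|\mathcal{D}_j^-\vartheta_i^s|\,|\mathcal{D}_j^-(\mathcal{D}_j^-\vartheta^s)_{i+he_j}|\Big),$$ $$\kappa_3^s:=\sum_{i,j}(\rho_i^s)^2\Big(|\mathcal{D}_j^+\vartheta_i^s|^3+|\mathcal{D}_j^-\vartheta_i^s|^3\Big)|\vartheta_i^s-\vartheta_\infty^s|,$$ $$\kappa_4^s:=\sum_{i,j}\rho_i^s\Big(|\mathcal{D}_j^+\rho_i^s|\,|\mathcal{D}_j^+\vartheta_i^s|^2+|\mathcal{D}_j^-\rho_i^s|\,|\mathcal{D}_j^-\vartheta_i^s|^2\Big)|\vartheta_i^s-\vartheta_\infty^s|,$$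 $$\kappa_5^s:=\kappa_0^s\sum_{i}\rho_i^s\,|\vartheta_i^s-\vartheta_\infty^s|,$$ $$\kappa_6^s:=\sum_{i,j}\Big(|\mathcal{D}_j^+(\rho_i^s)^2|\,|\mathcal{D}_j^+(\mathcal{D}_j^+\vartheta^s)_i|+|\mathcal{D}_j^-(\rho_i^s)^2|\,|\mathcal{D}_j^-(\mathcal{D}_j^-\vartheta^s)_i|+h(\rho_i^s)^2|\mathcal{L}_j^2\vartheta_i^s|\Big)|\vartheta_i^s-\vartheta_\infty^s|,$$ $$\kappa_7^s:=\sum_{i,j}\Big(|\mathcal{D}_j^+\rho_i^s|^2|\mathcal{D}_j^+\vartheta_i^s|+|\mathcal{D}_j^-\rho_i^s|^2|\mathcal{D}_j^-\vartheta_i^s|\Big)|\vartheta_i^s-\vartheta_\infty^s|.$$ *)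

(* Defs.v *)
From HB Require Import structures.
From mathcomp Require Import all_boot all_order all_algebra.
From mathcomp Require Import complex.
From mathcomp Require Import all_classical all_reals all_analysis.
From mathcomp Require Import ring lra.

Set Implicit Arguments.
Unset Strict Implicit.
Unset Printing Implicit Defensive.

Import Order.TTheory GRing.Theory Num.Theory.

Local Open Scope classical_set_scope.
Local Open Scope ring_scope.
Local Open Scope complex_scope.

(* The point (h * m, h * n) of the grid h Z^2 (h > 0) is encoded by the pair
   (m, n), so that the translation i + h e_j of the grid becomes i + e j;
   the two directions are indexed by 'I_2, i.e. from 0. *)
Definition lattice := (int * int)%type.

Definition e (j : 'I_2) : lattice := if j == 0 then (1, 0) else (0, 1).

Inductive sgn := Plus | Minus.

Definition D (R : realType) (h : R) (s : sgn) (j : 'I_2) (g : lattice -> R) :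
    lattice -> R :=
  fun i => match s with
           | Plus => (g (i + e j) - g i) / h
           | Minus => (g i - g (i - e j)) / h
           end.

Definition L_ (R : realType) (h : R) (j : 'I_2) (g : lattice -> R) :
    lattice -> R :=
  fun i => (g (i + e j) + g (i - e j) - 2 * g i) / h ^+ 2.

Definition L (R : realType) (h : R) (g : lattice -> R) : lattice -> R :=
  fun i => \sum_(j < 2) L_ h j g i.

Definition expi (R : realType) (t : R) : R[i] := cos t +i* sin t.

(* Principal argument; the value at z = 0 is irrelevant. *)
Definition arg (R : realType) (z : R[i]) : R :=
  xget 0 [set t : R | - pi < t <= pi /\ z = `|z| * expi t].

Lemma arg_unique (R : realType) (t t' : R) :
  - pi < t <= pi -> - pi < t' <= pi -> expi t = expi t' -> t = t'.
Proof.
move=> /andP[lt tu] /andP[lt' tu'] [ec es].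
wlog tt' : t t' lt tu lt' tu' ec es / t <= t'.
  move=> H; have [|/ltW] := leP t t'; first exact: H.
  by move=> h; apply/esym/H.
have [t0|t0] := leP 0 t.
  by apply: cos_inj => //; rewrite in_itv/=; apply/andP; split => //; lra.
have [t'0|t'0] := leP t' 0.
  apply: oppr_inj; apply: cos_inj; rewrite ?cosN// in_itv/=;
    by apply/andP; split; lra.
have et : - t = t'.
  apply: cos_inj; rewrite ?cosN// in_itv/=;
    by apply/andP; split; lra.
have : 0 < sin t' by apply: sin_gt0_pi; apply/andP; split; lra.
by move: es; rewrite -et sinN => es s0; lra.
Qed.

Lemma argP (R : realType) (z : R[i]) : z != 0 ->
  - pi < arg z <= pi /\ z = `|z| * expi (arg z).
Proof.
move=> z0; rewrite /arg; case: xgetP => [t _ []//|].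
move=> H; exfalso.
case: z z0 H => a b z0 H.
set r := Num.sqrt (a ^+ 2 + b ^+ 2).
have r2 : r ^+ 2 = a ^+ 2 + b ^+ 2 by rewrite sqr_sqrtr ?addr_ge0 ?sqr_ge0.
have ab0 : 0 < a ^+ 2 + b ^+ 2.
  rewrite lt0r addr_ge0 ?sqr_ge0// andbT paddr_eq0 ?sqr_ge0// !sqrf_eq0.
  by move: z0; rewrite eq_complex/=.
have r0 : 0 < r by rewrite sqrtr_gt0.
have rn0 : r != 0 by rewrite gt_eqF.
have c1 : (a / r) ^+ 2 + (b / r) ^+ 2 = 1.
  by rewrite !expr_div_n -mulrDl -r2 divff// expf_neq0.
have cB : -1 <= a / r <= 1.
  by have h := sqr_ge0 (b / r); apply/andP; split; nra.
pose t := if 0 <= b then acos (a / r) else - acos (a / r).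
have sE : sin (acos (a / r)) = `|b| / r.
  rewrite sin_acos// (_ : 1 - _ = (b / r) ^+ 2); last by lra.
  by rewrite sqrtr_sqr normrM normfV (gtr0_norm r0).
apply: (H t); split.
  have := acos_ge0 cB; have := acos_lepi cB; have := pi_gt0 R.
  rewrite /t; case: ifPn => b0; first by move=> *; apply/andP; split; lra.
  move=> p0 hp h0; apply/andP; split; last by lra.
  rewrite ltrN2 lt_neqAle hp andbT; apply/eqP => e.
  move: sE; rewrite e sinpi => /esym/eqP.
  by rewrite mulf_eq0 invr_eq0 (negbTE rn0) orbF normr_eq0 => /eqP bE;
    rewrite bE lexx in b0.
have cE : cos t = a / r by rewrite /t; case: ifP; rewrite ?cosN acosK ?in_itv.
have tE : sin t = b / r.
  rewrite /t; case: ifPn => b0; first by rewrite sE ger0_norm.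
  by rewrite sinN sE ltr0_norm -?mulNr ?opprK// ltNge.
rewrite normc_def /expi cE tE /=; simpc.
by rewrite -/r ![r * _]mulrC !divfK.
Qed.

Definition U (R : realType) (h : R) (u : lattice -> R) (s : sgn) :
    lattice -> R[i] :=
  fun i => D h s 0 u i +i* D h s 1 u i.

(* The norm of R[i] takes its values in R[i], hence the real part. *)
Definition rho (R : realType) (h : R) (u : lattice -> R) (s : sgn) :
    lattice -> R :=
  fun i => complex.Re `|U h u s i|.

Definition theta (R : realType) (h : R) (u : lattice -> R) (s : sgn) :
    lattice -> R :=
  fun i => arg (U h u s i).

Definition lsum (R : realType) (a : lattice -> R) : \bar R :=
  (\esum_(i in [set: lattice]) (a i)%:E)%E.

Definition kappa1 (R : realType) (h : R) (u : lattice -> R) (s : sgn) :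
    \bar R :=
  ereal_sup [set x : \bar R |
    exists (i : lattice) (j : 'I_2), x = `|D h s j u i|%:E].

Definition kappa2 (R : realType) (h : R) (u : lattice -> R) (s : sgn) :
    \bar R :=
  let r := rho h u s in let t := theta h u s in
  lsum (fun i => \sum_(j < 2) r i ^+ 2 *
    (`|D h Plus j t i| * `|D h Plus j (D h Plus j t) (i - e j)|
     + `|D h Minus j t i| * `|D h Minus j (D h Minus j t) (i + e j)|)).

Definition kappa3 (R : realType) (h : R) (u : lattice -> R) (s : sgn)
    (tinf : R) : \bar R :=
  let r := rho h u s in let t := theta h u s in
  lsum (fun i => \sum_(j < 2) r i ^+ 2 *
    (`|D h Plus j t i| ^+ 3 + `|D h Minus j t i| ^+ 3) * `|t i - tinf|).

Definition kappa4 (R : realType) (h : R) (u : lattice -> R) (s : sgn)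
    (tinf : R) : \bar R :=
  let r := rho h u s in let t := theta h u s in
  lsum (fun i => \sum_(j < 2) r i *
    (`|D h Plus j r i| * `|D h Plus j t i| ^+ 2
     + `|D h Minus j r i| * `|D h Minus j t i| ^+ 2) * `|t i - tinf|).

Definition kappa5 (R : realType) (h : R) (u : lattice -> R) (s : sgn)
    (kappa0 tinf : R) : \bar R :=
  let r := rho h u s in let t := theta h u s in
  (kappa0%:E * lsum (fun i => (r i * `|t i - tinf|)%R))%E.

Definition kappa6 (R : realType) (h : R) (u : lattice -> R) (s : sgn)
    (tinf : R) : \bar R :=
  let r := rho h u s in let t := theta h u s in
  let r2 := fun i => r i ^+ 2 in
  lsum (fun i => \sum_(j < 2)
    (`|D h Plus j r2 i| * `|D h Plus j (D h Plus j t) i|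
     + `|D h Minus j r2 i| * `|D h Minus j (D h Minus j t) i|
     + h * r i ^+ 2 * `|L_ h j (L_ h j t) i|) * `|t i - tinf|).

Definition kappa7 (R : realType) (h : R) (u : lattice -> R) (s : sgn)
    (tinf : R) : \bar R :=
  let r := rho h u s in let t := theta h u s in
  lsum (fun i => \sum_(j < 2)
    (`|D h Plus j r i| ^+ 2 * `|D h Plus j t i|
     + `|D h Minus j r i| ^+ 2 * `|D h Minus j t i|) * `|t i - tinf|).

Definition energy (R : realType) (h : R) (u : lattice -> R) : \bar R :=
  let term s i j := rho h u s i ^+ 2 *
    (`|D h Plus j (theta h u s) i| ^+ 2
     + `|D h Minus j (theta h u s) i| ^+ 2) in
  lsum (fun i => \sum_(j < 2) (term Plus i j + term Minus i j)).

Definition constC (R : realType) (h : R) (u : lattice -> R)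
    (kappa0 tinf : sgn -> R) : \bar R :=
  let both (k : sgn -> \bar R) := (k Plus + k Minus)%E in
  let k2 := both (fun s => kappa2 h u s) in
  let k3 := both (fun s => kappa3 h u s (tinf s)) in
  let k4 := both (fun s => kappa4 h u s (tinf s)) in
  let k5 := both (fun s => kappa5 h u s (kappa0 s) (tinf s)) in
  let k6 := both (fun s => kappa6 h u s (tinf s)) in
  let k7 := both (fun s => kappa7 h u s (tinf s)) in
  let c := (2 * expR (2 * pi))%:E in
  (4%:E * (k2 + c * k3 + c * k4 + 2%:E * k5 + k6 + k7))%E.

(* Main.v *)
Require Import Defs.
From HB Require Import structures.
From mathcomp Require Import all_boot all_order all_algebra.
From mathcomp Require Import complex.
From mathcomp Require Import all_classical all_reals all_analysis.
From mathcomp Require Import ring lra.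

Import Order.TTheory GRing.Theory Num.Theory.
Import numFieldNormedType.Exports.

Local Open Scope classical_set_scope.
Local Open Scope ring_scope.

(** Fix a sign s and write X, Y for the two components of U^s, r and t for
    rho^s and theta^s, w = t - theta_inf, r_+ and w_+ for the values at
    i + e_j, d = w_+ - w for an increment of t, and D for a difference
    quotient.

    As L commutes with differences, both X and Y solve L Z = c Z up to an error
    of order h.  The potential c disappears from X (L Y) - Y (L X), and this
    expression is the discrete divergence, over h ^ 2, of
    W_j(i) = X(i) Y(i + e_j) - Y(i) X(i + e_j) = r r_+ sin d.  Hence W has
    divergence at most h ^ 3 kappa0 r in absolute value: this is the discrete
    form of div (rho^2 grad theta) = 0 ([div_wronskian], [wronskian_polar]).

    Testing this balance against w and summing by parts bounds the sum of
    2 r r_+ sin d * d / h ^ 2 over the edges by 2 h kappa5.  Nothing is left at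
    infinity: r is bounded since kappa1 is finite and the sum of r |w| is finite
    since kappa5 is, so the fluxes W_j w_+ are absolutely summable and their
    divergence sums to zero ([le_lsum_div]).

    The energy, regrouped by edges ([lsum_half_edges]), is the sum of
    (r^2 + r_+^2) d^2 / h^2.  Replacing this density by 2 r r_+ sin d * d / h^2
    costs (r_+ - r)^2 d^2 / h^2 and 2 r r_+ d (d - sin d) / h^2.  One factor d
    of each is at most |w| + |w_+|, and |d - sin d| <= |d|^3 / 2, so what is
    left has the form of the summands of kappa3, kappa4 and kappa7 times h
    ([edge_ineq]).  For each sign this gives
    energy <= h (kappa3 + 2 pi kappa4 + kappa7 + 2 kappa5)
    ([energy_bound], [energy_sign]), and 1 + 2 pi <= exp (2 pi). *)

(** * The estimate on one edge *)

Lemma subr_sin_le_cubic (R : realType) (x : R) :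
  0 <= x -> x - sin x <= x ^+ 3 / 2.
Proof.
move=> x0.
have sin_sqr_le (y : R) : 0 <= y -> sin y ^+ 2 <= y ^+ 2.
  move=> y0.
  have [|c _] := MVT_segment (f := @sin R) (df := @cos R) y0 _.
    by apply: continuous_subspaceT; exact: continuous_sin.
  rewrite sin0 !subr0 => ->; rewrite exprMn ler_piMl ?sqr_ge0//.
have subr_cos_le (y : R) : 0 <= y -> 1 - cos y <= y ^+ 2 / 2.
  move=> y0; have y20 : 0 <= y / 2 by rewrite divr_ge0.
  have -> : 1 - cos y = 2 * sin (y / 2) ^+ 2.
    rewrite [in LHS](_ : y = y / 2 + y / 2); last by lra.
    by rewrite cosD; have := cos2Dsin2 (y / 2); lra.
  by have := sin_sqr_le _ y20; lra.
(* The mean value theorem, now for y - sin y, whose derivative is 1 - cos y. *)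
have [|c /itvP cx] := MVT_segment (f := fun y : R => y - sin y)
    (df := fun y => 1 - cos y) x0 _.
  apply: continuous_subspaceT => z; apply: cvgB; first exact: cvg_id.
  exact: continuous_sin.
rewrite sin0 !subr0 => ->.
have c0 : 0 <= c by rewrite cx.
have cle : c <= x by rewrite cx.
have : (1 - cos c) * x <= c ^+ 2 / 2 * x by rewrite ler_wpM2r ?subr_cos_le.
have : c ^+ 2 * x <= x ^+ 2 * x by rewrite ler_wpM2r// lerXn2r.
by rewrite -exprSr; lra.
Qed.

Lemma mulr_sin_ge (R : realType) (d : R) :
  d ^+ 2 - `|d| ^+ 3 * `|d| / 2 <= sin d * d.
Proof.
wlog d0 : d / 0 <= d.
  move=> H; have [/H//|/ltW d0] := leP 0 d.
  by have := H (- d); rewrite oppr_ge0 normrN sqrrN sinN mulrNN; apply.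
have := subr_sin_le_cubic _ _ d0; rewrite ger0_norm// => h3.
have : (d - sin d) * d <= d ^+ 3 / 2 * d by rewrite ler_wpM2r.
by rewrite expr2; lra.
Qed.

(** With a, b = r, r_+ and v, w = w, w_+ at the ends of an edge, this trades
    the energy density for the flux, up to terms each of which belongs to one
    endpoint: half-edges are what the sums kappa3, kappa4 and kappa7 consist
    of.  The product a b is split as a b <= a^2 + a |b - a| for the part
    weighted by |v| (symmetrically for |w|); in the second term one of the
    three powers of |d| is given up for K, which makes it of the form of
    kappa4. *)
Lemma edge_ineq (R : realType) (a b d v w K : R) :
  0 <= a -> 0 <= b -> w - v = d -> `|d| <= K ->
  (a ^+ 2 + b ^+ 2) * d ^+ 2 <= 2 * (a * b * sin d) * d
  + ((a ^+ 2 * `|d| ^+ 3 + K * (a * `|b - a| * `|d| ^+ 2)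
      + `|b - a| ^+ 2 * `|d|) * `|v|
   + (b ^+ 2 * `|d| ^+ 3 + K * (b * `|b - a| * `|d| ^+ 2)
      + `|b - a| ^+ 2 * `|d|) * `|w|).
Proof.
move=> a0 b0 wvd dK.
have dvw : `|d| <= `|v| + `|w| by rewrite -wvd addrC -(normrN v) ler_normD.
have := mulr_sin_ge _ d.
rewrite -(real_normK (num_real d)); set s := sin d * d.
rewrite (_ : 2 * _ * d = 2 * (a * b) * s); last by rewrite /s; ring.
have ba : (b - a) ^+ 2 = `|b - a| ^+ 2 by rewrite real_normK ?num_real.
have bg : b <= a + `|b - a| by rewrite -lerBlDl ler_norm.
have ag : a <= b + `|b - a| by rewrite distrC -lerBlDl ler_norm.
move: (normr_ge0 d) (normr_ge0 v) (normr_ge0 w) (normr_ge0 (b - a)) ba bg ag.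
move: dK dvw; move: `|d| `|v| `|w| `|b - a| => D V W P.
move=> DK DVW D0 V0 W0 P0 ba bg ag sge.
have ab0 : 0 <= a * b by rewrite mulr_ge0.
have D30 : 0 <= D ^+ 3 by rewrite exprn_ge0.
have D3K : D ^+ 3 <= K * D ^+ 2 by rewrite exprS ler_wpM2r ?sqr_ge0.
have h1 : 2 * (a * b) * (D ^+ 2 - D ^+ 3 * D / 2) <= 2 * (a * b) * s.
  by rewrite ler_wpM2l// mulr_ge0.
have h2 : a * b * D ^+ 3 * D <= a * b * D ^+ 3 * (V + W).
  by rewrite ler_wpM2l// mulr_ge0.
have h3 : a * b * D ^+ 3 * V <= (a ^+ 2 * D ^+ 3 + K * (a * P * D ^+ 2)) * V.
  apply: ler_wpM2r => //.
  have : a * b * D ^+ 3 <= a * (a + P) * D ^+ 3.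
    by rewrite ler_wpM2r// ler_wpM2l.
  have : a * P * D ^+ 3 <= a * P * (K * D ^+ 2).
    by rewrite ler_wpM2l// mulr_ge0.
  by rewrite expr2; lra.
have h4 : a * b * D ^+ 3 * W <= (b ^+ 2 * D ^+ 3 + K * (b * P * D ^+ 2)) * W.
  apply: ler_wpM2r => //.
  have : b * a * D ^+ 3 <= b * (b + P) * D ^+ 3.
    by rewrite ler_wpM2r// ler_wpM2l.
  have : b * P * D ^+ 3 <= b * P * (K * D ^+ 2).
    by rewrite ler_wpM2l// mulr_ge0.
  by rewrite expr2; lra.
have h5 : P ^+ 2 * D * D <= P ^+ 2 * D * (V + W).
  by rewrite ler_wpM2l// mulr_ge0// sqr_ge0.
have : (a ^+ 2 + b ^+ 2) * D ^+ 2 = 2 * (a * b) * D ^+ 2 + P ^+ 2 * D * D.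
  by rewrite -ba; ring.
by lra.
Qed.

(** * Sums over the lattice *)

Section LatticeSums.
Context {R : realType}.
Implicit Types a b x y : lattice -> R.

Lemma lsum_ge0 a : (forall i, 0 <= a i) -> (0 <= lsum a)%E.
Proof. by move=> a0; apply: esum_ge0 => i _; rewrite lee_fin. Qed.

Lemma eq_lsum a b : (forall i, a i = b i) -> lsum a = lsum b.
Proof. by move=> ab; apply: eq_esum => i _; rewrite ab. Qed.

Lemma le_lsum a b : (forall i, a i <= b i) -> (lsum a <= lsum b)%E.
Proof. by move=> ab; apply: le_esum => i _; rewrite lee_fin. Qed.

Lemma lsumD a b : (forall i, 0 <= a i) -> (forall i, 0 <= b i) ->
  lsum (fun i => a i + b i) = (lsum a + lsum b)%E.
Proof.
move=> a0 b0; rewrite /lsum -esumD => [||i _]; rewrite ?lee_fin//.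
by move=> i _; rewrite lee_fin.
Qed.

Lemma lsum_sum (I : finType) (a : I -> lattice -> R) :
  (forall j i, 0 <= a j i) ->
  lsum (fun i => \sum_j a j i) = (\sum_j lsum (a j))%E.
Proof.
move=> a0; rewrite /lsum -esum_sum => [|i j _ _]; last by rewrite lee_fin.
by apply: eq_esum => i _; rewrite sumEFin.
Qed.

Lemma lsumZ_le c a : 0 <= c -> (forall i, 0 <= a i) ->
  (lsum (fun i => (c * a i)%R) <= c%:E * lsum a)%E.
Proof.
move=> c0 a0; apply: ge_ereal_sup => _ [F FT <-].
under eq_fsbigr do rewrite EFinM.
rewrite -ge0_mule_fsumr => [|i]; last by rewrite lee_fin.
by rewrite lee_wpmul2l ?lee_fin//; apply: ereal_sup_ubound; exists F.
Qed.

Lemma lsum_translate (v : lattice) a : lsum (fun i => a (i + v)) = lsum a.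
Proof.
rewrite /lsum [RHS](reindex_esum setT setT (fun i => i + v))//.
by rewrite setTT_bijective; exists (fun i => i - v) => i;
  rewrite ?addrK ?subrK//.
Qed.

(** The second family is indexed by the far ends of the edges; moving it back to
    the near ends is a translation in each direction separately. *)
Lemma lsum_regroup (a b : 'I_2 -> lattice -> R) :
  (forall j i, 0 <= a j i) -> (forall j i, 0 <= b j i) ->
  lsum (fun i => \sum_(j < 2) (a j i + b j (i - e j)))
  = lsum (fun i => \sum_(j < 2) (a j i + b j i)).
Proof.
move=> a0 b0; rewrite !lsum_sum => [||j i]; rewrite ?addr_ge0//; last first.
  by move=> j i; rewrite addr_ge0.
apply: eq_bigr => j _; rewrite !lsumD//; congr (_ + _)%E.
exact: (lsum_translate (- e j) (b j)).
Qed.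

(** A pointwise inequality that holds up to the divergence of a summable flux
    can be summed: this is the summation by parts on the whole lattice.  To stay
    within sums of nonnegative terms, Q is written as P - |Q| with P = |Q| + Q,
    and the inflow and the outflow, which have the same finite sum, are added
    to the two sides. *)
Lemma le_lsum_div x y (Q : 'I_2 -> lattice -> R) :
  (forall i, 0 <= x i) -> (forall i, 0 <= y i) ->
  (forall j, (lsum (fun i => `|Q j i|%R) < +oo)%E) ->
  (forall i, x i <= y i + \sum_(j < 2) (Q j i - Q j (i - e j))) ->
  (lsum x <= lsum y)%E.
Proof.
move=> x0 y0 Qfin xy.
pose P j i := `|Q j i| + Q j i.
have Pge0 j i : 0 <= P j i.
  by rewrite /P; have := ler_norm (- Q j i); rewrite normrN; lra.
have nQ0 j i : 0 <= `|Q j i| by [].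
have S0 j i : 0 <= P j i + `|Q j i| by rewrite addr_ge0.
have Sge0 i : 0 <= \sum_(j < 2) (P j i + `|Q j i|) by rewrite sumr_ge0.
have Sfin : lsum (fun i => \sum_(j < 2) (P j i + `|Q j i|)) \is a fin_num.
  rewrite ge0_fin_numE ?lsum_ge0// lsum_sum//.
  apply: lte_sum_pinfty => j _.
  apply: (@le_lt_trans _ _ (lsum (fun i => 3 * `|Q j i|))).
    by apply: le_lsum => i; rewrite /P; have := ler_norm (Q j i); lra.
  apply: le_lt_trans (lsumZ_le _ _ _ _) _ => //.
  by rewrite lte_mul_pinfty.
have outflow : lsum (fun i => \sum_(j < 2) (P j i + `|Q j (i - e j)|)%R)
    = lsum (fun i => \sum_(j < 2) (P j i + `|Q j i|)).
  exact: (lsum_regroup P (fun j i => `|Q j i|)).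
have inflow : lsum (fun i => \sum_(j < 2) (`|Q j i| + P j (i - e j))%R)
    = lsum (fun i => \sum_(j < 2) (P j i + `|Q j i|)).
  rewrite (lsum_regroup (fun j i => `|Q j i|) P)//.
  by apply: eq_lsum => i; apply: eq_bigr => j _; rewrite addrC.
rewrite -(leeD2rE _ _ Sfin) -{1}inflow -outflow.
rewrite -!lsumD//; try by move=> i; apply: sumr_ge0 => j _; rewrite addr_ge0.
apply: le_lsum => i; have := xy i.
by rewrite /P !big_ord_recl !big_ord0; lra.
Qed.

End LatticeSums.

(** * The conserved flux and the energy *)

Section Differences.
Context {R : realType}.
Implicit Types (h : R) (u r t : lattice -> R).

Lemma D_minus h j u i : D h Minus j u i = D h Plus j u (i - e j).
Proof. by rewrite /D subrK. Qed.

(** The two summands at i are the halves, at i, of the edges [i, i + e_j] and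
    [i - e_j, i]; summing edge by edge instead pairs the two halves of the same
    edge, on which all the difference quotients agree. *)
Lemma lsum_half_edges h r t (phi : lattice -> R -> R -> R) :
  (forall i p q, 0 <= p -> 0 <= q -> 0 <= phi i p q) ->
  lsum (fun i => \sum_(j < 2)
    (phi i `|D h Plus j r i| `|D h Plus j t i|
     + phi i `|D h Minus j r i| `|D h Minus j t i|))
  = lsum (fun i => \sum_(j < 2)
    (phi i `|D h Plus j r i| `|D h Plus j t i|
     + phi (i + e j) `|D h Plus j r i| `|D h Plus j t i|)).
Proof.
move=> phi0.
rewrite -(lsum_regroup (fun j i => phi i `|D h Plus j r i| `|D h Plus j t i|)
  (fun j i => phi (i + e j) `|D h Plus j r i| `|D h Plus j t i|)) => [|j i|j i];
  rewrite ?phi0//.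
by apply: eq_lsum => i; apply: eq_bigr => j _; rewrite !D_minus /= subrK.
Qed.

Lemma L_D h s j u i : L h (D h s j u) i = D h s j (L h u) i.
Proof.
rewrite /L /L_ /D !big_ord_recl !big_ord0; case: s.
  rewrite !(addrAC i (e j)); ring.
rewrite !(addrAC i (- e j)); ring.
Qed.

(** The flux of the phase: up to a factor, the discrete counterpart of
    X (grad Y) - Y (grad X) = rho^2 (grad theta). *)
Definition wronskian (X Y : lattice -> R) (j : 'I_2) (i : lattice) : R :=
  X i * Y (i + e j) - Y i * X (i + e j).

(** Discrete Green identity: the diagonal terms of L cancel. *)
Lemma div_wronskian h X Y i :
  (\sum_(j < 2) (wronskian X Y j i - wronskian X Y j (i - e j))) / h ^+ 2
  = X i * L h Y i - Y i * L h X i.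
Proof.
rewrite /wronskian /L /L_ !big_ord_recl !big_ord0 !subrK; ring.
Qed.

Lemma wronskian_polar (X Y r t : lattice -> R) j i :
  (forall k, X k = r k * cos (t k)) -> (forall k, Y k = r k * sin (t k)) ->
  wronskian X Y j i = r i * r (i + e j) * sin (t (i + e j) - t i).
Proof. by move=> XE YE; rewrite /wronskian !XE !YE sinB; ring. Qed.

(** The balance of the Wronskian tested against w = t - tinf.  The potential c
    drops out because X (c Y) - Y (c X) = 0; boundedness of r together with the summability of r |w| makes the boundary
    terms of the summation by parts vanish. *)
Lemma energy_bound h (X Y r t : lattice -> R) (c : lattice -> R)
    (k0 M tinf K : R) :
  0 < h -> 0 <= k0 -> 0 <= K ->
  (forall i, X i = r i * cos (t i)) -> (forall i, Y i = r i * sin (t i)) ->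
  (forall i, 0 <= r i <= M) -> (forall i k, `|t i - t k| <= K) ->
  (forall i, `|L h X i - c i * X i| + `|L h Y i - c i * Y i| <= k0 * h) ->
  (lsum (fun i => (r i * `|t i - tinf|)%R) < +oo)%E ->
  (lsum (fun i => (\sum_(j < 2) (r i ^+ 2 * `|D h Plus j t i| ^+ 2
                          + r i ^+ 2 * `|D h Minus j t i| ^+ 2))%R)
   <= lsum (fun i => (\sum_(j < 2)
     (h * ((r i ^+ 2 * `|D h Plus j t i| ^+ 3
           + K * (r i * `|D h Plus j r i| * `|D h Plus j t i| ^+ 2)
           + `|D h Plus j r i| ^+ 2 * `|D h Plus j t i|) * `|t i - tinf|)
     + h * ((r i ^+ 2 * `|D h Minus j t i| ^+ 3
           + K * (r i * `|D h Minus j r i| * `|D h Minus j t i| ^+ 2)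
           + `|D h Minus j r i| ^+ 2 * `|D h Minus j t i|)
          * `|t i - tinf|)))%R)
    + lsum (fun i => (2 * k0 * h * (r i * `|t i - tinf|))%R))%E.
Proof.
move=> h0 k00 K0 XE YE rM tK LXY wfin.
have r0 i : 0 <= r i by have /andP[] := rM i.
pose w i := t i - tinf.
pose phiE i (p q : R) := r i ^+ 2 * q ^+ 2.
pose phi i p q :=
  h * ((r i ^+ 2 * q ^+ 3 + K * (r i * p * q ^+ 2) + p ^+ 2 * q) * `|w i|).
have phiE0 i p q : 0 <= p -> 0 <= q -> 0 <= phiE i p q.
  by move=> p0 q0; rewrite /phiE mulr_ge0// sqr_ge0.
have phi0 i p q : 0 <= p -> 0 <= q -> 0 <= phi i p q.
  move=> p0 q0; have h0' := ltW h0; have ri := r0 i.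
  by rewrite /phi !(mulr_ge0, addr_ge0, exprn_ge0).
rewrite (lsum_half_edges h r t phiE phiE0) (lsum_half_edges h r t phi phi0).
rewrite -lsumD; last 2 first.
- by move=> i; apply: sumr_ge0 => j _; rewrite addr_ge0 ?phi0.
- by move=> i; rewrite !mulr_ge0// ltW.
have hn0 : h != 0 by rewrite gt_eqF.
(* W (w_+ - w) differs from the divergence of W w_+ by w times the divergence
   of W; the factor 2 is that of 2 a b in the edge estimate. *)
pose Q j i := 2 / h ^+ 2 * wronskian X Y j i * w (i + e j).
apply: (le_lsum_div _ _ Q).
- by move=> i; apply: sumr_ge0 => j _; rewrite addr_ge0 ?phiE0.
- move=> i; rewrite addr_ge0//; last by rewrite !mulr_ge0// ltW.
  by apply: sumr_ge0 => j _; rewrite addr_ge0 ?phi0.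
- move=> j; pose q i := r i * `|w i|.
  have q0 i : 0 <= q i by rewrite mulr_ge0.
  have C0 : 0 <= 2 / h ^+ 2 * M.
    rewrite mulr_ge0// ?divr_ge0 ?sqr_ge0//.
    by have /andP[/le_trans + /[dup] rM0] := rM 0; apply.
  apply: (@le_lt_trans _ _ (lsum (fun i => 2 / h ^+ 2 * M * q (i + e j))%R)).
    apply: le_lsum => i.
    rewrite /Q (wronskian_polar _ _ _ _ _ _ XE YE) /q !normrM.
    rewrite (ger0_norm (r0 i)) (ger0_norm (r0 _)) [`|2|]ger0_norm//.
    rewrite [`|_^-1|]ger0_norm ?invr_ge0 ?sqr_ge0//.
    rewrite [leLHS](_ : _ = 2 / h ^+ 2 * (r i * `|sin (t (i + e j) - t i)|)
                           * (r (i + e j) * `|w (i + e j)|)); last by ring.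
    apply: ler_wpM2r; first exact: q0.
    apply: ler_wpM2l; first by rewrite divr_ge0// sqr_ge0.
    have /andP[_ riM] := rM i; apply: le_trans riM.
    by rewrite ler_piMr// sin_max.
  apply: le_lt_trans (lsumZ_le _ _ C0 _) _; first by move=> i; exact: q0.
  by rewrite (lsum_translate (e j) q) lte_mul_pinfty// lee_fin.
move=> i.
have edge j : phiE i `|D h Plus j r i| `|D h Plus j t i|
      + phiE (i + e j) `|D h Plus j r i| `|D h Plus j t i|
    <= 2 / h ^+ 2 * wronskian X Y j i * (w (i + e j) - w i)
       + (phi i `|D h Plus j r i| `|D h Plus j t i|
          + phi (i + e j) `|D h Plus j r i| `|D h Plus j t i|).
  have wd : w (i + e j) - w i = t (i + e j) - t i by rewrite /w; ring.
  have := edge_ineq _ (r i) (r (i + e j)) (t (i + e j) - t i) (w i)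
    (w (i + e j)) K (r0 i) (r0 (i + e j)) wd (tK _ _).
  rewrite wd -(real_normK (num_real (t (i + e j) - t i))).
  rewrite (wronskian_polar _ _ _ _ _ _ XE YE) /phiE /phi /D /=.
  rewrite !normrM normfV (gtr0_norm h0).
  set d := `|t _ - t _|; set p := `|r _ - r _| => ineq.
  have h2 : 0 <= (h ^+ 2)^-1 by rewrite invr_ge0 sqr_ge0.
  move: ineq; rewrite -subr_ge0 => /(mulr_ge0 h2) ineq; rewrite -subr_ge0.
  by apply: le_trans ineq _; rewrite le_eqVlt; apply/orP; left;
    apply/eqP; field.
have balance : 2 * w i * ((\sum_(j < 2)
    (wronskian X Y j i - wronskian X Y j (i - e j))) / h ^+ 2)
    >= - (2 * k0 * h * (r i * `|w i|)).
  rewrite div_wronskian.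
  have -> : X i * L h Y i - Y i * L h X i
      = X i * (L h Y i - c i * Y i) - Y i * (L h X i - c i * X i) by ring.
  set ey := L h Y i - _; set ex := L h X i - _.
  have le1 : `|X i * ey - Y i * ex| <= r i * (k0 * h).
    apply: le_trans (ler_normB _ _) _; rewrite !normrM.
    have Xr : `|X i| <= r i.
      by rewrite XE normrM (ger0_norm (r0 i)) ler_piMr// cos_max.
    have Yr : `|Y i| <= r i.
      by rewrite YE normrM (ger0_norm (r0 i)) ler_piMr// sin_max.
    apply: (@le_trans _ _ (r i * (`|ex| + `|ey|))).
      by rewrite mulrDr addrC lerD// ler_wpM2r.
    by rewrite ler_wpM2l// LXY.
  have : `|w i * (X i * ey - Y i * ex)| <= `|w i| * (r i * (k0 * h)).
    by rewrite normrM ler_wpM2l.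
  by rewrite ler_norml => /andP[+ _]; lra.
have := edge ord0; have := edge (lift ord0 ord0); move: balance.
rewrite /Q !big_ord_recl !big_ord0 !subrK /phiE /phi /w.
by lra.
Qed.

End Differences.
(** * Polar coordinates of the discrete gradient *)

Section Polar.
Context {R : realType}.
Implicit Types (h : R) (u : lattice -> R) (s : sgn).

(** At z = 0 every angle is a polar angle, and [arg] still selects one in the
    range; so the bound and the polar form below hold for every z. *)
Lemma arg_range (z : R[i]) : - pi < arg z <= pi.
Proof.
have [->|/argP[]//] := eqVneq z 0.
rewrite /arg; case: xgetP => [t _ []//|/(_ 0)/=].
by rewrite normr0 mul0r oppr_lt0 pi_gt0 pi_ge0; case.
Qed.

Lemma rho_ge0 h u s i : 0 <= rho h u s i.
Proof. by rewrite /rho normc_def /= sqrtr_ge0. Qed.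

Lemma polarE (z : R[i]) :
  (complex.Re z = complex.Re `|z| * cos (arg z)) *
  (complex.Im z = complex.Re `|z| * sin (arg z)).
Proof.
have [->|/argP[_ zE]] := eqVneq z 0; first by rewrite normr0 /= !mul0r.
split; rewrite {1}zE; case: z {zE} => a b;
by rewrite normc_def /expi /= mul0r ?subr0 ?addr0.
Qed.

Lemma D0_polar h u s i : D h s 0 u i = rho h u s i * cos (theta h u s i).
Proof. exact: (polarE (U h u s i)).1. Qed.

Lemma D1_polar h u s i : D h s 1 u i = rho h u s i * sin (theta h u s i).
Proof. exact: (polarE (U h u s i)).2. Qed.

Lemma dist_theta_le h u s i k :
  `|theta h u s i - theta h u s k| <= 2 * pi.
Proof.
have /andP[a b] := arg_range (U h u s i).
have /andP[c d] := arg_range (U h u s k).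
by rewrite ler_norml /theta; apply/andP; split; lra.
Qed.

Lemma rho_bounded h u s : (kappa1 h u s < +oo)%E ->
  exists M, forall i, rho h u s i <= M.
Proof.
move=> k1.
have Dle i j : (`|D h s j u i|%:E <= kappa1 h u s)%E.
  by apply: ereal_sup_ubound; exists i, j.
have k1fin : kappa1 h u s \is a fin_num.
  by rewrite ge0_fin_numE//; apply: le_trans (Dle 0 0); rewrite lee_fin.
exists (2 * fine (kappa1 h u s)) => i.
have Dfine j : `|D h s j u i| <= fine (kappa1 h u s).
  by rewrite -lee_fin fineK.
have := Dfine 0; have := Dfine 1; move: (fine _) => m D1 D0.
rewrite /rho normc_def /=.
apply: (@le_trans _ _ (Num.sqrt ((`|D h s 0 u i| + `|D h s 1 u i|) ^+ 2))).
  rewrite ler_sqrt ?sqr_ge0// sqrrD !real_normK ?num_real//.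
  by rewrite lerD2r lerDl mulrn_wge0// mulr_ge0.
by rewrite sqrtr_sqr ger0_norm ?addr_ge0//; lra.
Qed.

Lemma energy_sign h u s (k0 tinf : R) (c : lattice -> R) :
  0 < h -> 0 < k0 ->
  (forall i, \sum_(j < 2) `|D h s j (L h u) i - c i * D h s j u i|
             <= k0 * h) ->
  (kappa1 h u s < +oo)%E -> (kappa5 h u s k0 tinf < +oo)%E ->
  (lsum (fun i => (\sum_(j < 2) rho h u s i ^+ 2 *
     (`|D h Plus j (theta h u s) i| ^+ 2
      + `|D h Minus j (theta h u s) i| ^+ 2))%R)
   <= h%:E * (kappa3 h u s tinf + (2 * pi)%:E * kappa4 h u s tinf
              + kappa7 h u s tinf + 2%:E * kappa5 h u s k0 tinf))%E.
Proof.
move=> h0 k00 lin k1 k5.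
have [M rM] := rho_bounded _ _ _ k1.
pose r := rho h u s; pose t := theta h u s.
have r0 i : 0 <= r i by exact: rho_ge0.
have w0 i : 0 <= r i * `|t i - tinf| by rewrite mulr_ge0.
have wfin : (lsum (fun i => (r i * `|t i - tinf|)%R) < +oo)%E.
  (* Positivity of k0 gives finiteness of the sum from that of the product. *)
  move: k5; rewrite /kappa5 -/r -/t; case: (lsum _) (lsum_ge0 _ w0) => [x _ _||//].
    exact: ltry.
  by rewrite gt0_muley ?lte_fin.
have LXY i : `|L h (D h s 0 u) i - c i * D h s 0 u i|
    + `|L h (D h s 1 u) i - c i * D h s 1 u i| <= k0 * h.
  by have := lin i; rewrite !L_D !big_ord_recl big_ord0 addr0.
have pi2 : 0 <= 2 * pi :> R by rewrite mulr_ge0// pi_ge0.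
have := energy_bound h _ _ r t c k0 M tinf (2 * pi) h0 (ltW k00) pi2
  (D0_polar h u s) (D1_polar h u s)
  (fun i => introT andP (conj (r0 i) (rM i))) (dist_theta_le h u s) LXY wfin.
under eq_lsum do under eq_bigr do rewrite -mulrDr.
move=> /le_trans; apply.
pose k3 i := \sum_(j < 2) r i ^+ 2 *
  (`|D h Plus j t i| ^+ 3 + `|D h Minus j t i| ^+ 3) * `|t i - tinf|.
pose k4 i := \sum_(j < 2) r i * (`|D h Plus j r i| * `|D h Plus j t i| ^+ 2
  + `|D h Minus j r i| * `|D h Minus j t i| ^+ 2) * `|t i - tinf|.
pose k7 i := \sum_(j < 2) (`|D h Plus j r i| ^+ 2 * `|D h Plus j t i|
  + `|D h Minus j r i| ^+ 2 * `|D h Minus j t i|) * `|t i - tinf|.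
have k30 i : 0 <= k3 i.
  by apply: sumr_ge0 => j _; rewrite !(mulr_ge0, addr_ge0, exprn_ge0).
have k40 i : 0 <= k4 i.
  by apply: sumr_ge0 => j _; rewrite !(mulr_ge0, addr_ge0, exprn_ge0).
have k70 i : 0 <= k7 i.
  by apply: sumr_ge0 => j _; rewrite !(mulr_ge0, addr_ge0, exprn_ge0).
under eq_lsum => i.
  rewrite (_ : \sum_(j < 2) _ = h * (k3 i + 2 * pi * k4 i + k7 i)); last first.
    by rewrite /k3 /k4 /k7 !big_ord_recl !big_ord0; ring.
  over.
have pk4 i : 0 <= 2 * pi * k4 i by rewrite mulr_ge0.
rewrite ge0_muleDr; last 2 first.
- by rewrite !adde_ge0 ?mule_ge0 ?lee_fin//; exact: lsum_ge0.
- by rewrite !mule_ge0 ?lee_fin ?(ltW k00)//; exact: lsum_ge0.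
apply: leeD.
  apply: le_trans (lsumZ_le _ _ (ltW h0) _) _.
    by move=> i; rewrite !addr_ge0.
  rewrite lee_pmul2l ?lte_fin// !lsumD//; last by move=> i; rewrite addr_ge0.
  by rewrite !leeD// lsumZ_le.
apply: le_trans (lsumZ_le _ _ _ w0) _; first by rewrite !mulr_ge0// ltW.
by rewrite /kappa5 !muleA -!EFinM (_ : 2 * k0 * h = h * 2 * k0)//; ring.
Qed.

End Polar.

(** * Adding the two signs *)

Theorem theorem1p2 (R : realType) (h : R) (h_gt0 : 0 < h) (h_le1 : h <= 1)
  (f : lattice -> R -> R) (u : lattice -> R)
  (u_sol : forall i : lattice, L h u i = f i (u i))
  (Lf : sgn -> lattice -> R -> R) (kappa0 : sgn -> R)
  (kappa0_gt0 : forall s, 0 < kappa0 s)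
  (f_plus : forall i : lattice,
    \sum_(j < 2)
      `|f (i + e j) (u (i + e j)) - f i (u i)
        - Lf Plus i (u i) * (u (i + e j) - u i)| / h
    <= kappa0 Plus * h)
  (f_minus : forall i : lattice,
    \sum_(j < 2)
      `|f i (u i) - f (i - e j) (u (i - e j))
        - Lf Minus i (u i) * (u i - u (i - e j))| / h
    <= kappa0 Minus * h)
  (nonvanish_plus : forall i : lattice, 0 < \sum_(j < 2) `|u (i + e j) - u i| ^+ 2)
  (nonvanish_minus : forall i : lattice, 0 < \sum_(j < 2) `|u (i - e j) - u i| ^+ 2)
  (kappa1_fin : forall s, (kappa1 h u s < +oo)%E)
  (kappa2_fin : forall s, (kappa2 h u s < +oo)%E)
  (theta_inf : sgn -> R)
  (theta_inf_range : forall s, - pi < theta_inf s <= pi)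
  (kappa3_fin : forall s, (kappa3 h u s (theta_inf s) < +oo)%E)
  (kappa4_fin : forall s, (kappa4 h u s (theta_inf s) < +oo)%E)
  (kappa5_fin : forall s, (kappa5 h u s (kappa0 s) (theta_inf s) < +oo)%E)
  (kappa6_fin : forall s, (kappa6 h u s (theta_inf s) < +oo)%E)
  (kappa7_fin : forall s, (kappa7 h u s (theta_inf s) < +oo)%E) :
  (energy h u <= constC h u kappa0 theta_inf * h%:E)%E.
Proof.
have lin s i : exists c, \sum_(j < 2) `|D h s j (L h u) i - c * D h s j u i|
    <= kappa0 s * h.
  have DE (a b c : R) : `|a - c * b| / h = `|a / h - c * (b / h)|.
    by rewrite mulrA -mulrBl normrM normfV (gtr0_norm h_gt0).
  case: s.
  - exists (Lf Plus i (u i)); apply: le_trans (f_plus i).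
    by under eq_bigr do rewrite /D !u_sol -DE.
  - exists (Lf Minus i (u i)); apply: le_trans (f_minus i).
    by under eq_bigr do rewrite /D !u_sol -DE.
have bound s := energy_sign h u s (kappa0 s) (theta_inf s) _ h_gt0
  (kappa0_gt0 s) (fun i => projT2 (cid (lin s i)))
  (kappa1_fin s) (kappa5_fin s).
(* The families kappa_2, ..., kappa_7 are collected under one index to treat
   nonnegativity and finiteness uniformly; other indices repeat kappa_7. *)
pose k s m : \bar R := match m with
  | 2 => kappa2 h u s | 3 => kappa3 h u s (theta_inf s)
  | 4 => kappa4 h u s (theta_inf s)
  | 5 => kappa5 h u s (kappa0 s) (theta_inf s)
  | 6 => kappa6 h u s (theta_inf s) | _ => kappa7 h u s (theta_inf s) end%N.
have r0 s i := rho_ge0 h u s i.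
have k0 s m : (0 <= k s m)%E.
  have kap0 : 0 <= kappa0 s by exact: ltW.
  have hge0 := ltW h_gt0.
  case: m => [|[|[|[|[|[|[|m]]]]]]]; rewrite /= ?mule_ge0 ?lee_fin//;
    apply: lsum_ge0 => i;
    first [by rewrite mulr_ge0
          | by apply: sumr_ge0 => j _; rewrite !(mulr_ge0, addr_ge0, exprn_ge0)].
have [a aE a0] : exists2 a : sgn -> nat -> R,
    forall s m, k s m = (a s m)%:E & forall s m, 0 <= a s m.
  exists (fun s m => fine (k s m)) => s m; last by rewrite fine_ge0.
  rewrite fineK// ge0_fin_numE//.
  by case: m => [|[|[|[|[|[|[|m]]]]]]] => /=.
rewrite /energy.
under eq_lsum do rewrite big_split /=.
rewrite lsumD; last 2 first.
- by move=> i; apply: sumr_ge0 => j _; rewrite mulr_ge0 ?addr_ge0 ?sqr_ge0.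
- by move=> i; apply: sumr_ge0 => j _; rewrite mulr_ge0 ?addr_ge0 ?sqr_ge0.
apply: le_trans (leeD (bound Plus) (bound Minus)) _.
rewrite /constC.
rewrite (aE Plus 2%N : kappa2 h u Plus = _).
rewrite (aE Minus 2%N : kappa2 h u Minus = _).
rewrite (aE Plus 3%N : kappa3 h u Plus _ = _).
rewrite (aE Minus 3%N : kappa3 h u Minus _ = _).
rewrite (aE Plus 4%N : kappa4 h u Plus _ = _).
rewrite (aE Minus 4%N : kappa4 h u Minus _ = _).
rewrite (aE Plus 5%N : kappa5 h u Plus _ _ = _).
rewrite (aE Minus 5%N : kappa5 h u Minus _ _ = _).
rewrite (aE Plus 6%N : kappa6 h u Plus _ = _).
rewrite (aE Minus 6%N : kappa6 h u Minus _ = _).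
rewrite (aE Plus 7%N : kappa7 h u Plus _ = _).
rewrite (aE Minus 7%N : kappa7 h u Minus _ = _).
rewrite !(=^~ EFinM, =^~ EFinD) lee_fin -mulrDr [leRHS]mulrC ler_pM2l//.
(* The weight 8 exp (2 pi) of kappa3 and kappa4 dominates 1 and 2 pi. *)
have Epi : 1 + 2 * pi <= expR (2 * pi) :> R by exact: expR_ge1Dx.
have pi0 : 0 <= pi :> R by exact: pi_ge0.
have E3 s : a s 3%N <= expR (2 * pi) * a s 3%N by rewrite ler_peMl//; lra.
have E4 s : 2 * pi * a s 4%N <= expR (2 * pi) * a s 4%N.
  by rewrite ler_wpM2r//; lra.
have := (a0 Plus 2%N, a0 Plus 3%N, a0 Plus 4%N, a0 Plus 5%N, a0 Plus 6%N,
  a0 Plus 7%N).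
move=> [[[[[]]]]]; move: (a0 Minus 2%N) (a0 Minus 3%N) (a0 Minus 4%N)
  (a0 Minus 5%N) (a0 Minus 6%N) (a0 Minus 7%N)
  (E3 Plus) (E3 Minus) (E4 Plus) (E4 Minus).
have := mulr_ge0 pi0 (a0 Plus 4%N); have := mulr_ge0 pi0 (a0 Minus 4%N).
by lra.
Qed.
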